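(* Let $n\ge 3$ and let $G$ be a graph on $n$ vertices. Let $a_t=t(n-t-1)$ and $b_t=t(n-2)$ for integers $t\ge 0$, and let $t_{\max}=\max\{t\in\mathbb{Z}_{\ge 0}: b_t<a_{t+1}\}=\max\{t\in\mathbb{Z}_{\ge0}: t(t+1)<n-2\}$. (i) If $f(G)<a_{t_{\max}+1}$, then $f(G)\in[a_t,b_t]$ for a unique integer $t$ with $0\le t\le t_{\max}$. (ii) For every integer $t$ with $0\le t\le t_{\max}$: $f(G)\in[a_t,b_t]$ if and only if $G$ can be obtained from a complete bipartite graph on the same $n$ vertices by flipping exactly $t$ (distinct) pairs of vertices.
   Context: All graphs are finite and simple. A triple of distinct vertices of a graph is a frustrated triangle if it induces an odd number of edges (exactly one or exactly three), and $f(G)$ denotes the number of frustrated triangles (unordered triples) in $G$. To flip a pair of distinct vertices $uv$ means to change its edge/nonedge status: if $uv$ is an edge it becomes a nonedge, and vice versa. A complete bipartite graph may have an empty part, so the edgeless graph $K_{0,n}$ counts as complete bipartite. (The number $a_t$ is the number of frustrated triangles in the $n$-vertex graph whose edges are $t$ edges forming a star, for $0\le t\le n-1$, and $b_t$ that of the $n$-vertex graph whose edges are $t$ edges forming a matching, for $0\le t\le n/2$.) *)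

(* Defs.v *)
From mathcomp Require Import all_boot all_order all_algebra.

Set Implicit Arguments.
Unset Strict Implicit.
Unset Printing Implicit Defensive.

Import Order.TTheory GRing.Theory Num.Theory.

(* A graph on the vertex set T is identified with its edge set, a set of
   2-element subsets of T. *)
Definition pairs (T : finType) : {set {set T}} :=
  [set e : {set T} | #|e| == 2].

Definition simple_graph (T : finType) (G : {set {set T}}) : bool :=
  G \subset pairs T.

Definition frustrated (T : finType) (G : {set {set T}}) : {set {set T}} :=
  [set S : {set T} | (#|S| == 3) && odd #|[set e in G | e \subset S]|].

Definition nb_frustrated (T : finType) (G : {set {set T}}) : nat :=
  #|frustrated G|.

(* A may be set0 or setT, in which case the graph is edgeless. *)
Definition complete_bipartite (T : finType) (G : {set {set T}}) : Prop :=
  exists A : {set T}, G = [set [set x; y] | x in A, y in ~: A].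

Definition flip (T : finType) (G F : {set {set T}}) : {set {set T}} :=
  (G :\: F) :|: (F :\: G).

Definition obtained_by_flipping (T : finType) (t : nat) (G : {set {set T}}) :
    Prop :=
  exists B F : {set {set T}},
    [/\ complete_bipartite B, F \subset pairs T, #|F| = t & G = flip B F].

Local Open Scope ring_scope.

(* Integer-valued because a n t is negative for t >= n. *)
Definition a (n t : nat) : int := t%:Z * (n%:Z - t%:Z - 1).

Definition b (n t : nat) : int := t%:Z * (n%:Z - 2).

Definition is_max (P : nat -> Prop) (m : nat) : Prop :=
  P m /\ forall t : nat, P t -> (t <= m)%N.

(* Main.v *)
Require Import Defs.
From mathcomp Require Import all_boot all_order all_algebra.
From mathcomp Require Import zify.

Set Implicit Arguments.
Unset Strict Implicit.
Unset Printing Implicit Defensive.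

Import Order.TTheory GRing.Theory Num.Theory.
Local Open Scope ring_scope.

(** Every triple spans an even number (0 or 2) of edges of a complete bipartite
    graph, so flipping the pairs of such a graph, i.e. switching, changes
    neither the set of frustrated triples nor their number
    ([frustrated_switch]). Hence if [G] comes from a complete bipartite graph by
    flipping the [m] pairs of [F], then [f(G) = f(F)].

    Write [c_S] for the number of edges of [F] inside a triple [S]. Each pair
    lies in [n - 2] triples, so the [c_S] add up to [m (n - 2)]; two distinct
    pairs lie in at most one common triple, so the [c_S (c_S - 1)] add up to at
    most [m (m - 1)]. As [(c mod 2) <= c <= (c mod 2) + c (c - 1)] for every
    natural number [c], summing over the triples gives [a_m <= f(F) <= b_m]
    ([flipping_bounds]). This holds for all [m]; moreover
    [a_t <= b_t < a_(t+1)] for [t <= tmax], so the intervals [[a_t, b_t]] with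
    [t <= tmax] are pairwise disjoint and lie in increasing order.

    Put [s = tmax + 1]. It remains to see that [f(G) < a_s] makes [G] obtainable
    by fewer than [s] flips. Switching [G] at the neighbourhood of a vertex [v]
    isolates [v], and the resulting graph has as many edges as there are
    frustrated triples through [v] ([card_isolate]). Averaging over [v], some
    choice leaves [m] edges with [n m <= 3 f(G)]. Now
    [a_m <= f(G) < a_s], and [a_s - a_m = (s - m) (n - 1 - s - m)], so either
    [m < s] or [m >= n - s]. In the latter case
    [n (n - s) <= 3 f(G) <= 3 s (n - 1 - s) - 3], that is
    [(n - s) (n - 3 s) + 3 s + 3 <= 0], which contradicts
    [s (s - 1) = tmax (tmax + 1) < n - 2] ([few_edges]). *)

Section Switching.
Local Open Scope nat_scope.
Variable T : finType.
Implicit Types (A S e : {set T}) (B F G : {set {set T}}) (v : T).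

(** * Invariance under switching *)

(** The edges of [F] with both ends in [S]. *)
Definition edges_in F S : {set {set T}} := [set e in F | e \subset S].

(** The complete bipartite graph with parts [A] and its complement. *)
Definition cut A : {set {set T}} := [set [set x; y] | x in A, y in ~: A].

Lemma flipK B F : flip B (flip B F) = F.
Proof.
by apply/setP=> e; rewrite !inE; case: (e \in B); case: (e \in F).
Qed.

Lemma odd_flip_edges B F S :
  odd #|edges_in (flip B F) S| = odd #|edges_in B S| (+) odd #|edges_in F S|.
Proof.
set X := edges_in B S; set Y := edges_in F S.
have -> : edges_in (flip B F) S = (X :\: Y) :|: (Y :\: X).
  apply/setP=> e; rewrite !inE.
  by case: (e \in B); case: (e \in F); case: (e \subset S).
(* modulo 2, both sides are |X \ Y| + |Y \ X| *)
rewrite cardsU.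
have -> : (X :\: Y) :&: (Y :\: X) = set0.
  by apply/setP=> e; rewrite !inE; case: (e \in F); case: (e \in B);
     case: (e \subset S).
rewrite cards0 subn0 oddD -(cardsID Y X) -(cardsID X Y) setIC !oddD.
by case: (odd _); case: (odd _); case: (odd _).
Qed.

Lemma mem_cut A x y : x \in A -> ([set x; y] \in cut A) = (y \notin A).
Proof.
move=> xA; apply/imset2P/idP => [[p q pA]|yA]; last first.
  by exists x y; rewrite ?inE.
rewrite inE => qA E.
have : q \in [set x; y] by rewrite E !inE eqxx orbT.
by rewrite !inE => /orP[] /eqP Eq; rewrite -?Eq // Eq xA in qA *.
Qed.

Lemma card_cut_edges A S :
  #|edges_in (cut A) S| = #|A :&: S| * #|S :\: A|.
Proof.
rewrite -cardsX.
have inj : {in setX (A :&: S) (S :\: A) &,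
    injective (fun p : T * T => [set p.1; p.2])}.
  move=> [x y] [x' y'] /setXP[/= /setIP[xA _] /setDP[_ yA]].
  move=> /setXP[/= /setIP[xA' _] /setDP[_ yA']] E.
  have : x \in [set x'; y'] by rewrite -E !inE eqxx.
  rewrite !inE => /orP[]/eqP Ex; last by rewrite -Ex xA in yA'.
  have : y \in [set x'; y'] by rewrite -E !inE eqxx orbT.
  rewrite !inE => /orP[]/eqP Ey; first by rewrite Ey xA' in yA.
  by rewrite Ex Ey.
rewrite -(card_in_imset inj); apply: eq_card => e.
apply/setIdP/imsetP => [[/imset2P[x y xA]]|[[x y]]].
  rewrite inE => yA -> /subsetP sub.
  exists (x, y) => //; rewrite !inE /= xA yA /=.
  by rewrite !sub // !inE eqxx ?orbT.
move=> /setXP[/= /setIP[xA xS] /setDP[yS yA]] ->; split.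
  by rewrite mem_cut.
by apply/subsetP=> z; rewrite !inE => /orP[] /eqP ->.
Qed.

(** For a triple [S], the sizes of [A :&: S] and [S :\: A] add up to 3, so one
    of them is even and the cut [A] has an even number of edges inside [S]. *)
Lemma frustrated_switch B F :
  complete_bipartite B -> frustrated (flip B F) = frustrated F.
Proof.
case=> A ->; apply/setP=> S; rewrite !inE.
have [/eqP cS|//] := boolP (#|S| == 3); congr andb.
rewrite -/(edges_in _ S) odd_flip_edges card_cut_edges oddM.
have : odd (#|A :&: S| + #|S :\: A|) by rewrite setIC cardsID cS.
by rewrite oddD; case: (odd #|A :&: S|); case: (odd #|S :\: A|).
Qed.

(** * Frustrated triples of a graph with few edges *)

Lemma card_triples_over e : #|e| = 2 ->
  #|[set S : {set T} | (#|S| == 3) && (e \subset S)]| = #|T| - 2.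
Proof.
move=> ce.
have inj : {in ~: e &, injective (fun x => x |: e)}.
  move=> x y; rewrite !inE => xe ye E.
  have : x \in y |: e by rewrite -E !inE eqxx.
  by rewrite !inE (negPf xe) orbF => /eqP.
have -> : #|T| - 2 = #|~: e| by rewrite -(cardsC e) ce addKn.
rewrite -(card_in_imset inj); apply: eq_card => S; rewrite inE.
apply/andP/imsetP => [[/eqP cS sub]|[x]]; last first.
  by rewrite inE => xe ->; rewrite cardsU1 xe ce subsetUr.
have : #|S :\: e| == 1 by rewrite cardsD (setIidPr sub) cS ce.
case/cards1P=> x E; exists x.
  have : x \in S :\: e by rewrite E inE.
  by rewrite !inE => /andP[].
by rewrite -E setUC -{1}(setID S e) (setIidPr sub).
Qed.

(** Such a triple [S] can only be the union of [e] and [e']. *)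
Lemma triple_over_pairs_uniq e e' : #|e| = 2 -> #|e'| = 2 -> e != e' ->
  #|[set S : {set T} | [&& #|S| == 3, e \subset S & e' \subset S]]| <= 1.
Proof.
move=> ce ce' ne; rewrite -[leqRHS](cards1 (e :|: e')); apply/subset_leq_card/subsetP.
move=> S; rewrite !inE => /and3P[/eqP cS eS e'S].
rewrite eq_sym eqEcard subUset eS e'S cS /= ltnNge.
apply: contra ne => le.
have E1 : e = e :|: e' by apply/eqP; rewrite eqEcard subsetUl ce.
have E2 : e' = e :|: e' by apply/eqP; rewrite eqEcard subsetUr ce'.
by rewrite E1 -E2.
Qed.

(** Here and below, booleans are summed as the numbers 0 and 1. *)
Lemma card_edges_in F S : #|edges_in F S| = \sum_(e in F) (e \subset S).
Proof.
rewrite -sum1_card big_mkcond [RHS]big_mkcond; apply: eq_bigr => e _.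
by rewrite inE; case: (e \in F); case: (e \subset S).
Qed.

Lemma sum_subset_bool (P : pred {set T}) (Q : pred {set T}) :
  \sum_(S | P S) Q S = #|[set S | P S && Q S]|.
Proof.
rewrite -sum1_card big_mkcond [RHS]big_mkcond; apply: eq_bigr => S _.
by rewrite inE; case: (P S); case: (Q S).
Qed.

Lemma nb_frustratedE F :
  nb_frustrated F = \sum_(S : {set T} | #|S| == 3) odd #|edges_in F S|.
Proof. by rewrite sum_subset_bool. Qed.

Lemma sum_edges_in F : simple_graph F ->
  \sum_(S : {set T} | #|S| == 3) #|edges_in F S| = #|F| * (#|T| - 2).
Proof.
move=> /subsetP sF.
under eq_bigr do rewrite card_edges_in.
rewrite exchange_big /= -sum_nat_const; apply: eq_bigr => e /sF.
by rewrite inE => /eqP ce; rewrite sum_subset_bool card_triples_over.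
Qed.

(** The left-hand side counts the ordered pairs of distinct edges inside a
    common triple. *)
Lemma sum_edge_pairs F : simple_graph F ->
  \sum_(S : {set T} | #|S| == 3) #|edges_in F S| * #|edges_in F S|.-1
    <= #|F| * #|F|.-1.
Proof.
move=> /subsetP sF.
have E S : #|edges_in F S| * #|edges_in F S|.-1
    = \sum_(e in F) (e \subset S) * \sum_(e' in F :\ e) (e' \subset S).
  rewrite {1}card_edges_in big_distrl; apply: eq_bigr => e eF /=.
  case: (boolP (e \subset S)) => // eS; congr (_ * _).
  by rewrite card_edges_in (big_setD1 _ eF) eS.
under eq_bigr do rewrite E.
rewrite exchange_big -sum_nat_const; apply: leq_sum => e eF /=.
under eq_bigr do rewrite big_distrr.
rewrite exchange_big /= (cardsD1 e F) eF -sum1_card.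
apply: leq_sum => e' /setD1P[ne e'F].
under eq_bigr do rewrite mulnb.
rewrite sum_subset_bool; apply: triple_over_pairs_uniq.
- by apply/eqP; move/sF: eF; rewrite inE.
- by apply/eqP; move/sF: e'F; rewrite inE.
- by rewrite eq_sym.
Qed.

Lemma nb_frustrated_le F : simple_graph F ->
  nb_frustrated F <= #|F| * (#|T| - 2).
Proof.
move=> sF; rewrite -sum_edges_in // nb_frustratedE.
by apply: leq_sum => S _; case: #|edges_in F S| => // c; case: odd.
Qed.

(** The lower bound [m (n - 1 - m)], with its negative terms moved to the right:
    it follows from [c <= odd c + c * c.-1] applied to each triple. *)
Lemma nb_frustrated_ge F : simple_graph F ->
  #|F| * (#|T| - 2) <= nb_frustrated F + #|F| * #|F|.-1.
Proof.
move=> sF.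
apply: leq_trans (leq_add (leqnn _) (sum_edge_pairs sF)).
rewrite -sum_edges_in // nb_frustratedE -big_split /=.
by apply: leq_sum => S _; case: #|edges_in F S| => [|[|c]] //=; nia.
Qed.

(** * Isolating a vertex by switching *)

(** The graph [G] switched at the neighbourhood of [v]. *)
Definition isolate v G := flip (cut [set x | [set v; x] \in G]) G.

Lemma simple_not_loop G v : simple_graph G -> [set v; v] \notin G.
Proof.
by move=> /subsetP sG; apply/negP=> /sG; rewrite inE setUid cards1.
Qed.

Lemma cut_simple A : simple_graph (cut A).
Proof.
apply/subsetP=> e /imset2P[x y xA]; rewrite !inE => yA ->.
by rewrite cards2; case: (x =P y) => [E|//]; rewrite -E xA in yA.
Qed.

Lemma flip_simple B F : simple_graph B -> simple_graph F ->
  simple_graph (flip B F).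
Proof.
move=> sB sF; rewrite /simple_graph /flip subUset.
by rewrite (subset_trans (subsetDl _ _) sB) (subset_trans (subsetDl _ _) sF).
Qed.

Lemma isolate_simple v G : simple_graph G -> simple_graph (isolate v G).
Proof. by move=> sG; apply: flip_simple => //; apply: cut_simple. Qed.

Lemma cutC A : cut (~: A) = cut A.
Proof.
by apply/setP=> e; apply/imset2P/imset2P=> -[x y xA yA ->];
  exists y x; rewrite ?setCK ?(setUC [set x]) // in xA yA *.
Qed.

(** The vertex [v] is isolated in [isolate v G]. *)
Lemma isolateP v G e : simple_graph G -> e \in isolate v G -> v \notin e.
Proof.
move=> sG eI; apply/negP => ve.
(* the other end x of e is a neighbour of v in G iff {v, x} is in the cut *)
have : #|e :\ v| == 1.
  move/subsetP: (isolate_simple v sG) => /(_ e eI); rewrite inE.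
  by rewrite (cardsD1 v) ve.
case/cards1P=> x Ex; move: eI; rewrite -(setD1K ve) Ex.
rewrite /isolate -cutC inE !in_setD.
rewrite mem_cut ?inE ?(negPf (simple_not_loop v sG)) // negbK.
by case: (_ \in G).
Qed.

(** The map [e |-> v |: e] is a bijection from the edges of [isolate v G] onto
    the triples through [v] frustrated in [isolate v G], or equally in [G]. *)
Lemma card_isolate v G : simple_graph G ->
  #|isolate v G| = #|[set S in frustrated G | v \in S]|.
Proof.
move=> sG.
have sI := isolate_simple v sG.
have <- : frustrated (isolate v G) = frustrated G.
  by apply: frustrated_switch; eexists.
have iso e := @isolateP v G e sG.
move: (isolate v G) sI iso => F /subsetP sF iso.
have inj : {in F &, injective (fun e => v |: e)}.
  by move=> e e' eF e'F /= E; rewrite -(setU1K (iso _ eF)) E setU1K ?iso.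
(* a triple through v spans at most one edge, the pair opposite to v *)
have spans S : v \in S -> #|S| = 3 -> edges_in F S = F :&: [set S :\ v].
  move=> vS cS; apply/setP=> e; rewrite !inE.
  case: (boolP (e \in F)) => //= eF.
  rewrite eqEcard subsetD1 iso // andbT.
  move: (sF _ eF); rewrite inE => /eqP ->.
  have -> : #|S :\ v| = 2 by move: cS; rewrite (cardsD1 v) vS; lia.
  by rewrite andbT.
rewrite -(card_in_imset inj); apply: eq_card => S; rewrite inE.
apply/imsetP/andP=> [[e eF ->]|[]].
  move: (sF _ eF); rewrite inE => /eqP ce.
  have c3 : #|v |: e| = 3 by rewrite cardsU1 iso // ce.
  have vS : v \in v |: e by rewrite setU11.
  rewrite vS inE c3 -/(edges_in F _) spans // setU1K ?iso //; split => //.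
  by rewrite (setIidPr _) ?sub1set // cards1.
rewrite inE => /andP[/eqP cS]; rewrite -/(edges_in F S) => + vS.
rewrite spans // => od; exists (S :\ v); last by rewrite setD1K.
apply: contraLR od => nF; rewrite (_ : F :&: _ = set0) ?cards0 //.
by apply/setP=> e; rewrite !inE andbC; case: eqP => // ->; apply: negbTE.
Qed.

(** Each frustrated triple is counted once for each of its vertices. *)
Lemma sum_card_isolate G : simple_graph G ->
  \sum_v #|isolate v G| = 3 * nb_frustrated G.
Proof.
move=> sG; under eq_bigr do rewrite card_isolate // -sum1dep_card big_mkcondr.
rewrite exchange_big /= mulnC -sum_nat_const.
apply: eq_bigr => S; rewrite inE => /andP[/eqP cS _].
by rewrite -big_mkcond sum1_card.
Qed.

Lemma exists_isolate_le G : simple_graph G -> 0 < #|T| ->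
  exists v, #|T| * #|isolate v G| <= 3 * nb_frustrated G.
Proof.
move=> sG /card_gt0P[v0 _].
case: (@arg_minnP _ v0 predT (fun v => #|isolate v G|) isT) => v _ vmin.
exists v; rewrite -sum_card_isolate // -sum_nat_const.
by apply: leq_sum => w _; apply: vmin.
Qed.

Lemma obtained_isolate v G : simple_graph G ->
  obtained_by_flipping #|isolate v G| G.
Proof.
move=> sG; exists (cut [set x | [set v; x] \in G]), (isolate v G); split => //.
- by eexists.
- exact: isolate_simple.
- by rewrite flipK.
Qed.

End Switching.

(** * The intervals [[a_t, b_t]] *)

(** No restriction on [t] is needed here. *)
Lemma flipping_bounds (n t : nat) (T : finType) (G : {set {set T}}) :
  (2 <= n)%N -> #|T| = n -> obtained_by_flipping t G ->
  a n t <= (nb_frustrated G)%:Z <= b n t.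
Proof.
move=> n2 cT [B [F [cB sF <- ->]]].
rewrite /nb_frustrated frustrated_switch // -/(nb_frustrated F).
have := nb_frustrated_le sF; have := nb_frustrated_ge sF.
rewrite cT /a /b; move: (nb_frustrated F) (#|F|) => f [|m] /=; nia.
Qed.

Lemma lt_b_aS (n t : nat) :
  (b n t < a n t.+1) = (t%:Z * (t%:Z + 1) < n%:Z - 2).
Proof. by rewrite /a /b; apply/idP/idP; nia. Qed.

(** If each gap from [b_k] to [a_(k+1)] with [k <= s] is positive, then the
    intervals of index at most [s + 1] lie in increasing order. *)
Lemma b_lt_a (n s t u : nat) : (2 <= n)%N ->
  (forall k : nat, (k <= s)%N -> b n k < a n k.+1) ->
  (t < u)%N -> (u <= s.+1)%N -> b n t < a n u.
Proof.
move=> n2 gap; elim: u => // u IH; rewrite ltnS leq_eqVlt => /orP[/eqP ->|tu] us.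
  exact: gap.
have := IH tu (ltnW us); have := gap u us.
have : a n u <= b n u by rewrite /a /b; clear -n2; case: u => [|u]; nia.
lia.
Qed.

(** The first hypothesis says [s (s - 1) < n - 2], without subtraction. *)
Lemma few_edges (n s m f : nat) :
  (s * s + 3 <= n + s)%N -> (n * m <= 3 * f)%N -> a n m <= f%:Z ->
  f%:Z < a n s -> (m < s)%N.
Proof.
rewrite /a => ns mf am fa; rewrite ltnNge; apply/negP => sm.
(* h1 is a_s > a_m; with s <= m, both factors are negative *)
have h1 : (s%:Z - m%:Z) * (n%:Z - 1 - s%:Z - m%:Z) > 0 by lia.
have h2 : n%:Z - s%:Z <= m%:Z by nia.
have h3 : n%:Z * (n%:Z - s%:Z) <= 3 * f%:Z by nia.
have h4 : (n%:Z - s%:Z) * (n%:Z - 3 * s%:Z) + 3 * s%:Z + 3 <= 0 by nia.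
(* n >= s^2 - s + 3 gives n >= 3s unless s = 2, where h4 fails anyway *)
case: (leqP s 2) => s2.
  by move: s2 ns h4; clear; case: s => [|[|[|]]] //; nia.
have : 3 * s%:Z <= n%:Z by nia.
nia.
Qed.

Theorem theorem1 (n : nat) (T : finType) (G : {set {set T}})
    (hn : (3 <= n)%N) (hT : #|T| = n) (hG : simple_graph G) :
  exists tmax : nat,
    [/\ is_max (fun t : nat => b n t < a n t.+1) tmax,
        is_max (fun t : nat => t%:Z * (t%:Z + 1) < n%:Z - 2) tmax,
        ((nb_frustrated G)%:Z < a n tmax.+1 ->
           exists! t : nat,
             (t <= tmax)%N /\ a n t <= (nb_frustrated G)%:Z <= b n t)
      & forall t : nat, (t <= tmax)%N ->
          (a n t <= (nb_frustrated G)%:Z <= b n t <->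
           obtained_by_flipping t G)].
Proof.
(* tmax is the largest t with t (t + 1) < n - 2; t = 0 qualifies as n >= 3 *)
pose P (t : nat) := t%:Z * (t%:Z + 1) < n%:Z - 2.
have exP : exists t, P t by exists 0%N; rewrite /P; lia.
have ubP t : P t -> (t <= n)%N by rewrite /P; nia.
case: (ex_maxnP exP ubP) => s Ps smax; exists s.
have gap k : (k <= s)%N -> b n k < a n k.+1.
  by move=> ks; rewrite lt_b_aS; move: Ps; rewrite /P; nia.
have n2 : (2 <= n)%N by exact: ltnW.
have disj t u : (t <= s)%N -> (u <= s)%N ->
    a n t <= (nb_frustrated G)%:Z <= b n t ->
    a n u <= (nb_frustrated G)%:Z <= b n u -> t = u.
  move=> ts us /andP[at_ bt] /andP[au bu].
  case: (ltngtP t u) => // lt.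
    by have := b_lt_a n2 gap lt (leqW us); lia.
  by have := b_lt_a n2 gap lt (leqW ts); lia.
have main : (nb_frustrated G)%:Z < a n s.+1 -> exists t : nat,
    [/\ (t <= s)%N, a n t <= (nb_frustrated G)%:Z <= b n t
      & obtained_by_flipping t G].
  move=> fa.
  have T0 : (0 < #|T|)%N by rewrite hT; lia.
  have [v le] := exists_isolate_le hG T0.
  have fl := obtained_isolate v hG.
  have bds := flipping_bounds n2 hT fl.
  exists #|isolate v G|; split => //; rewrite -ltnS.
  rewrite hT in le; apply: few_edges le _ fa; last by case/andP: bds.
  by move: Ps; rewrite /P; nia.
split.
- split; first by rewrite lt_b_aS.
  by move=> t; rewrite lt_b_aS; apply: smax.
- by split.
- move=> /main[t [ts bds _]]; exists t; split => // u [us bds'].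
  exact: disj bds bds'.
- move=> t ts; split; last exact: flipping_bounds.
  move=> bds; case: main => [|u [us bds' fl]].
    by have /andP[_] := bds; have := b_lt_a n2 gap (ts : (t < s.+1)%N) (leqnn _); lia.
  by rewrite (disj t u).
Qed.
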